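(* Let $q \ge 2$ be an integer and let $0<\delta<1/q$. There is a constant $c>0$ depending only on $q$ and $\delta$ such that the following holds for every $n$. Let $C \subseteq \{0,1\}^n$ be a binary linear code which is $q$-locally correctable with density parameter $\delta$, i.e., for every coordinate $i \in [n]$, either $C^\perp$ contains the unit vector $e_i$, or $C^\perp$ contains at least $\delta n$ vectors of Hamming weight $q+1$ whose supports all contain $i$ and are pairwise disjoint apart from $i$. Then the covering radius of $C^\perp$ is at most $c\, n^{\frac{q-2}{q-1}}$, and \[ \dim(C) \le c\, n^{\frac{q-2}{q-1}} (\log n)^{\frac{1}{q-1}}. \]
   Context: $C^\perp=\{y\in\{0,1\}^n : \langle x,y\rangle = 0 \text{ for all } x\in C\}$ is the dual code over $\mathbb F_2$. The covering radius of a linear code $D\subseteq\{0,1\}^n$ is $\max_{x\in\{0,1\}^n}\min_{y\in D}|x-y|$ (Hamming distance). The paper states the bounds in $O(\cdot)$ notation, with the hidden constants allowed to depend on $\delta$ (and the fixed $q$). *)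

(* Defs.v *)
From HB Require Import structures.
From mathcomp Require Import all_boot all_order all_algebra.
From mathcomp Require Import reals exp.

Set Implicit Arguments.
Unset Strict Implicit.
Unset Printing Implicit Defensive.

Import Order.TTheory GRing.Theory Num.Theory.
Local Open Scope ring_scope.

Notation word n := 'rV['F_2]_n.

Definition supp (n : nat) (x : word n) : {set 'I_n} := [set i | x 0 i != 0].

Definition weight (n : nat) (x : word n) : nat := #|supp x|.

Definition inner (n : nat) (x y : word n) : 'F_2 := \sum_(i < n) x 0 i * y 0 i.

Definition dual_code (n : nat) (C : {vspace word n}) : {set word n} :=
  [set y | [forall x in C, inner x y == 0]].

(* The Hamming distance is the weight of the difference, so it never exceeds
   [n]: for nonempty [D] the default value [n] does not affect the minimum. *)
Definition covering_radius (n : nat) (D : {set word n}) : nat :=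
  \max_(x : word n) \big[minn/n]_(y in D) weight (x - y).

(* [delta_mx 0 i] is the unit vector e_i. *)
Definition locally_correctable (R : realType) (q : nat) (delta : R) (n : nat)
    (C : {vspace word n}) : Prop :=
  forall i : 'I_n,
    delta_mx 0 i \in dual_code C \/
    exists S : {set word n},
      [/\ S \subset dual_code C,
          delta * n%:R <= #|S|%:R,
          forall y, y \in S -> weight y = q.+1 /\ i \in supp y
        & forall y z, y \in S -> z \in S -> y != z ->
            [disjoint supp y :\ i & supp z :\ i]].

(* Main.v *)
(* For a set A of coordinates, work in the quotient of F_2^n by C^perp + F_2^A.
   If A is random of density p, a local correction y of i, of weight q + 1, has
   q - 2 prescribed coordinates inside A with probability w = p^(q-2), and it
   then becomes a relation e_i = e_a + e_b. By Chebyshev, all coordinates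
   outside A, except for 4/(delta w) of them which are added to A, have at
   least delta n w / 2 disjoint relations of this kind. So the simple random
   walk on the Cayley graph of the quotient has positive coarse Ricci curvature
   (neighbouring starting points are coupled through these relations), and
   the diameter r of this graph is at most 2/(delta w).
   Every word is thus, modulo C^perp, a word supported on A plus a word of weight
   at most r. Hence the covering radius is at most |A| + r, and
   dim C <= |A| + r log2 (n+1). Take p = n^(-1/(q-1)) for the former bound and
   p = (ln n / n)^(1/(q-1)) for the latter. *)

Require Import Defs.
From HB Require Import structures.
From mathcomp Require Import all_boot all_order all_algebra.
From mathcomp Require Import reals exp.
From mathcomp Require Import zify ring lra.

Set Implicit Arguments.
Unset Strict Implicit.
Unset Printing Implicit Defensive.

Import Order.TTheory GRing.Theory Num.Theory.
Local Open Scope ring_scope.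

(** * Moments of a random subset of density [p] *)

Section RandomSubset.

Variables (R : realFieldType) (T : finType) (p : R).

Definition subset_prob (A : {set T}) : R := \prod_t (if t \in A then p else 1 - p).

Definition expect (g : {set T} -> R) : R := \sum_A subset_prob A * g A.

(** Expand [\prod_t (p + c_t)], where [c_t] is 0 on [B] and [1 - p] elsewhere, over the set [A] of
    indices at which [p] is chosen: exactly the terms with [B \subset A] survive. *)
Lemma expect_superset (B : {set T}) :
  expect (fun A => (B \subset A)%:R) = p ^+ #|B|.
Proof.
have -> : p ^+ #|B| = \prod_t (p + (if t \in B then 0 else 1 - p)).
  rewrite (bigID [in B]) /= [X in _ * X]big1 => [|t /negPf->]; last by ring.
  by rewrite mulr1 (eq_bigr (fun=> p)) ?prodr_const // => t ->; rewrite addr0.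
rewrite bigA_distr; apply: eq_bigr => A _.
have [sBA|/subsetPn[t tB tA]] := boolP (B \subset A).
  rewrite mulr1; apply: eq_bigr => t _; case: ifPn => // tA.
  by case: ifP => // /(subsetP sBA); rewrite (negPf tA).
by rewrite mulr0 [RHS](bigD1 t) //= (negPf tA) tB mul0r.
Qed.

Lemma expect_sum (I : finType) (P : pred I) (g : I -> {set T} -> R) :
  expect (fun A => \sum_(i | P i) g i A) = \sum_(i | P i) expect (g i).
Proof. by rewrite exchange_big; apply: eq_bigr => A _; rewrite mulr_sumr. Qed.

Lemma expectD (g h : {set T} -> R) :
  expect (fun A => g A + h A) = expect g + expect h.
Proof. by rewrite -big_split; apply: eq_bigr => A _; rewrite mulrDr. Qed.

Lemma expectZ (a : R) (g : {set T} -> R) :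
  expect (fun A => a * g A) = a * expect g.
Proof. by rewrite mulr_sumr; apply: eq_bigr => A _; rewrite mulrCA. Qed.

Lemma expect_cst (a : R) : expect (fun=> a) = a.
Proof.
(* Total mass 1 is the case of the empty set. *)
have := expect_superset set0; rewrite cards0 expr0 => E1.
rewrite -[RHS]mulr1 -E1 -expectZ; apply: eq_bigr => A _.
by rewrite sub0set mulr1.
Qed.

Lemma expect_card : expect (fun A => #|A|%:R) = #|T|%:R * p.
Proof.
transitivity (expect (fun A => \sum_t ([set t] \subset A)%:R)).
  apply: eq_bigr => A _; congr (_ * _).
  rewrite -sum1_card natr_sum big_mkcond.
  by apply: eq_bigr => t _; rewrite sub1set; case: (t \in A).
rewrite expect_sum (eq_bigr (fun=> p)) => [|t _]; first last.
  by rewrite expect_superset cards1.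
by rewrite sumr_const mulr_natl.
Qed.

(** The events [B y \subset A] are pairwise independent because the [B y] are disjoint, so the
    variance of their count is at most its mean. *)
Lemma second_moment (U : finType) (S : {set U}) (B : U -> {set T}) (k : nat) :
  0 <= p ->
  {in S, forall y, #|B y| = k} ->
  {in S &, forall y z, y != z -> [disjoint B y & B z]} ->
  expect (fun A => (\sum_(y in S) (B y \subset A)%:R - #|S|%:R * p ^+ k) ^+ 2)
    <= #|S|%:R * p ^+ k.
Proof.
move=> p_ge0 cardB disjB; set m := #|S|%:R * p ^+ k.
have m_ge0 : 0 <= m by rewrite mulr_ge0 ?exprn_ge0.
pose X (A : {set T}) : R := \sum_(y in S) (B y \subset A)%:R.
pose X2 (A : {set T}) : R := \sum_(y in S) \sum_(z in S) (B y :|: B z \subset A)%:R.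
have EX : expect X = m.
  rewrite expect_sum (eq_bigr (fun=> p ^+ k)) => [|y yS].
    by rewrite sumr_const /m mulr_natl.
  by rewrite expect_superset cardB.
have EX2 : expect X2 <= m + m ^+ 2.
  rewrite expect_sum.
  have -> : m + m ^+ 2 = \sum_(y in S) (p ^+ k + m * p ^+ k).
    by rewrite sumr_const -mulr_natl /m; ring.
  apply: ler_sum => y yS; rewrite expect_sum (bigD1 y yS) /=.
  rewrite setUid expect_superset cardB // lerD2l.
  have -> : m * p ^+ k = \sum_(z in S) p ^+ (k + k).
    by rewrite sumr_const -mulr_natl /m exprD mulrA.
  (* The right side also counts [z = y]; this surplus [p ^+ (k + k)] is dropped. *)
  rewrite [leRHS](bigD1 y yS) /=.
  rewrite -[leLHS]add0r lerD ?exprn_ge0 // ler_sum // => z /andP[zS zy].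
  rewrite expect_superset cardsU !cardB //.
  move: (disjB _ _ zS yS zy); rewrite disjoint_sym -setI_eq0 => /eqP->.
  by rewrite cards0 subn0.
have -> : expect (fun A => (X A - m) ^+ 2)
    = expect (fun A => X2 A + (- (2 * m) * X A + m ^+ 2)).
  apply: eq_bigr => A _; congr (_ * _).
  have -> : X2 A = X A * X A.
    rewrite [RHS]mulr_suml; apply: eq_bigr => y _; rewrite mulr_sumr.
    by apply: eq_bigr => z _; rewrite subUset -natrM mulnb.
  ring.
by rewrite !expectD expectZ expect_cst EX; move: EX2; lra.
Qed.

Hypotheses (p_ge0 : 0 <= p) (p_le1 : p <= 1).

Lemma subset_prob_ge0 (A : {set T}) : 0 <= subset_prob A.
Proof. by apply: prodr_ge0 => t _; case: ifP; rewrite ?subr_ge0. Qed.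

Lemma le_expect (g h : {set T} -> R) :
  (forall A, g A <= h A) -> expect g <= expect h.
Proof. by move=> gh; apply: ler_sum => A _; rewrite ler_wpM2l ?subset_prob_ge0. Qed.

(** If [g] exceeded its mean everywhere, the zero mean of [g - expect g] would have nonnegative
    terms only, forcing every probability to be 0. *)
Lemma exists_le_expect (g : {set T} -> R) : exists A, g A <= expect g.
Proof.
apply/existsP; apply: contraT; rewrite negb_exists => /forallP lt_g.
have gt0 A : 0 <= subset_prob A * (g A - expect g).
  by rewrite mulr_ge0 ?subset_prob_ge0 // subr_ge0 ltW // ltNge.
have : expect (fun A => g A - expect g) = 0 by rewrite expectD expect_cst subrr.
move/(psumr_eq0P (fun A _ => gt0 A)) => prob0.
have := expect_cst 1; rewrite /expect big1 => [/eqP|A _].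
  by rewrite eq_sym oner_eq0.
have /eqP := prob0 A isT; rewrite mulf_eq0 subr_eq0 => /orP[/eqP->|/eqP E].
  by rewrite mul0r.
by have := lt_g A; rewrite E lexx.
Qed.

End RandomSubset.

(** * Binary words as sets of coordinates, and a comparison of two sums *)

Section BinaryWords.

Variable n : nat.
Implicit Types (x y : word n) (A K : {set 'I_n}).

Lemma F2_eq_neq0 (a : 'F_2) : a = (a != 0)%:R.
Proof. by case: a => [[|[|?]] ?] //; apply: val_inj. Qed.

Lemma word_addxx x : x + x = 0.
Proof.
apply/rowP => i; rewrite !mxE.
by case: (x 0 i) => [[|[|?]] ?] //; apply: val_inj.
Qed.

Definition indicator K : word n := \row_i (i \in K)%:R.

Lemma supp_indicator K : supp (indicator K) = K.
Proof.
by apply/setP => i; rewrite inE mxE; case: (i \in K); rewrite ?oner_eq0 ?eqxx.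
Qed.

Lemma indicator_supp x : indicator (supp x) = x.
Proof. by apply/rowP => i; rewrite mxE inE -F2_eq_neq0. Qed.

Lemma indicator0 : indicator set0 = 0.
Proof. by apply/rowP => i; rewrite !mxE inE. Qed.

Lemma indicator1 i : indicator [set i] = delta_mx 0 i.
Proof. by apply/rowP => j; rewrite !mxE inE. Qed.

Lemma indicatorU A K : [disjoint A & K] ->
  indicator (A :|: K) = indicator A + indicator K.
Proof.
move=> dAK; apply/rowP => i; rewrite !mxE inE.
have [iA|_] := boolP (i \in A); last by rewrite add0r.
by rewrite (disjointFr dAK iA) addr0.
Qed.

Lemma supp0 : supp (0 : word n) = set0.
Proof. by rewrite -indicator0 supp_indicator. Qed.

Lemma suppD x y : supp (x + y) \subset supp x :|: supp y.
Proof.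
apply/subsetP => i; rewrite !inE mxE; apply: contraR.
by rewrite negb_or !negbK => /andP[/eqP-> /eqP->]; rewrite addr0.
Qed.

End BinaryWords.

(** The two sums agree on each block, so the loss of 1 per index is paid only outside the blocks,
    which cover [k * #|S|] indices. This is a coupling of two random steps in summed form. *)
Lemma sum_exchange_leq (T U : finType) (f g : T -> nat) (S : {set U})
    (Q : U -> {set T}) (k : nat) :
  {in S, forall y, #|Q y| = k} ->
  {in S &, forall y z, y != z -> [disjoint Q y & Q z]} ->
  {in S, forall y, (\sum_(t in Q y) f t = \sum_(t in Q y) g t)%N} ->
  (forall t, f t <= g t + 1)%N ->
  (\sum_t f t + k * #|S| <= \sum_t g t + #|T|)%N.
Proof.
move=> cardQ disjQ eqfg le_fg.
(* Emptying the blocks outside [S] makes the family disjoint over all of [U]. *)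
pose Q' y := if y \in S then Q y else set0.
have disjQ' y z : y != z -> [disjoint Q' y & Q' z].
  rewrite /Q'; case: ifP => [yS|_]; last by rewrite -setI_eq0 set0I.
  by case: ifP => [zS|_]; [exact: disjQ|rewrite -setI_eq0 setI0].
pose P := \bigcup_y Q' y.
have sumP (h : T -> nat) : (\sum_(t in P) h t = \sum_y \sum_(t in Q' y) h t)%N.
  exact: partition_disjoint_bigcup.
have cardP : #|P| = (k * #|S|)%N.
  rewrite -sum1_card sumP mulnC -sum_nat_const [RHS]big_mkcond.
  apply: eq_bigr => y _; rewrite sum1_card /Q'.
  by case: ifP => [/cardQ|]; rewrite ?cards0.
have eqP_ : (\sum_(t in P) f t = \sum_(t in P) g t)%N.
  rewrite !sumP; apply: eq_bigr => y _.
  by rewrite /Q'; case: ifP => [/eqfg//|_]; rewrite !big_set0.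
rewrite (bigID [in P]) /= eqP_ [in leqRHS](bigID [in P]) /= -!addnA leq_add2l -cardP.
have -> : #|T| = (\sum_(t | t \notin P) 1 + #|P|)%N.
  by rewrite sum1_card addnC (cardC P).
by rewrite addnA leq_add2r -big_split leq_sum // => t _; apply: le_fg.
Qed.

(** * Coset weights and the curvature of the walk on the quotient *)

Section CosetWeight.

Variables (n : nat) (C : {vspace word n}).
Implicit Types (x y v : word n).

Local Notation e_ i := (delta_mx 0%R i : word n).

Lemma dual0 : 0 \in dual_code C.
Proof.
rewrite inE; apply/forall_inP => x _; rewrite /inner big1 // => i _.
by rewrite mxE mulr0.
Qed.

Lemma dualD x y : x \in dual_code C -> y \in dual_code C -> x + y \in dual_code C.
Proof.
rewrite !inE => /forall_inP Dx /forall_inP Dy; apply/forall_inP => c cC.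
have -> : inner c (x + y) = inner c x + inner c y.
  by rewrite -big_split; apply: eq_bigr => i _; rewrite mxE mulrDr.
by rewrite (eqP (Dx c cC)) (eqP (Dy c cC)) addr0.
Qed.

Variable A : {set 'I_n}.

(* The weight of the coset leader of [x] modulo [dual_code C] + F_2^A. *)
Definition coset_weight x : nat :=
  #|supp (x - [arg min_(y < 0 in dual_code C) #|supp (x - y) :\: A|]) :\: A|.

Lemma coset_weight_le x y : y \in dual_code C ->
  (coset_weight x <= #|supp (x - y) :\: A|)%N.
Proof.
by rewrite /coset_weight; case: arg_minnP => [|z _]; [exact: dual0|apply].
Qed.

Lemma coset_weightP x :
  exists2 y, y \in dual_code C & #|supp (x - y) :\: A| = coset_weight x.
Proof.
by rewrite /coset_weight; case: arg_minnP => [|y Dy _]; [exact: dual0|exists y].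
Qed.

Lemma coset_weightD x v :
  (coset_weight (x + v) <= coset_weight x + coset_weight v)%N.
Proof.
have [y Dy <-] := coset_weightP x; have [z Dz <-] := coset_weightP v.
apply: leq_trans (coset_weight_le _ (dualD Dy Dz)) _.
apply: leq_trans (leq_card_setU _ _); rewrite -setDUl subset_leq_card //.
by rewrite setSD // opprD addrACA suppD.
Qed.

Lemma coset_weight_supp x : (coset_weight x <= #|supp x :\: A|)%N.
Proof. by have := coset_weight_le x dual0; rewrite subr0. Qed.

Lemma coset_weight_dual y : y \in dual_code C -> coset_weight y = 0%N.
Proof.
move=> Dy; apply/eqP; rewrite -leqn0 (leq_trans (coset_weight_le _ Dy)) //.
by rewrite subrr supp0 set0D cards0.
Qed.

Lemma coset_weight_delta i : (coset_weight (e_ i) <= 1)%N.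
Proof.
rewrite -indicator1 (leq_trans (coset_weight_supp _)) // supp_indicator.
by rewrite (leq_trans (subset_leq_card (subsetDl _ _))) ?cards1.
Qed.

(** Subadditivity gives one inequality; applied at [x + v] it gives the other, since [v + v = 0]. *)
Lemma coset_weight_translate x v : coset_weight v = 0%N ->
  coset_weight (x + v) = coset_weight x.
Proof.
move=> v0; have le w : (coset_weight (w + v) <= coset_weight w)%N.
  by rewrite -[leqRHS]addn0 (leq_trans (coset_weightD w v)) // leq_add2l v0.
apply/eqP; rewrite eqn_leq; apply/andP; split; first exact: le.
by have := le (x + v); rewrite -addrA (word_addxx v) (addr0 x).
Qed.

Lemma coset_weight_step x i :
  (coset_weight (x + e_ i) <= coset_weight x + 1)%N.
Proof.
by rewrite (leq_trans (coset_weightD _ _)) // leq_add2l coset_weight_delta.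
Qed.

(** This is [n] times the mean coset weight after one step of the walk from [x], left unnormalised
    to stay in the naturals. *)
Definition neighbour_sum x : nat := \sum_k coset_weight (x + e_ k).

Lemma neighbour_sum_translate x v : coset_weight v = 0%N ->
  neighbour_sum (x + v) = neighbour_sum x.
Proof.
move=> v0; apply: eq_bigr => k _.
by rewrite addrAC; exact: coset_weight_translate.
Qed.

Lemma neighbour_sum0 : (neighbour_sum 0 <= n)%N.
Proof.
rewrite -[X in (_ <= X)%N]card_ord -sum1_card leq_sum // => k _.
by rewrite add0r coset_weight_delta.
Qed.

Lemma neighbour_sum_ge x : (n * coset_weight x <= neighbour_sum x + n)%N.
Proof.
have -> : (n * coset_weight x = \sum_(k < n) coset_weight x)%N.
  by rewrite sum_nat_const card_ord.
rewrite [X in (_ <= _ + X)%N](_ : n = (\sum_(k < n) 1)%N); last first.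
  by rewrite sum1_card card_ord.
rewrite -big_split leq_sum // => k _ /=.
have := coset_weight_step (x + e_ k) k.
by rewrite -(addrA x) (word_addxx (e_ k)) (addr0 x).
Qed.

(* Each relation e_i = e_a + e_b pairs the step a from x with the step b from
   x + e_i, and these lead to the same coset. *)
Lemma neighbour_sum_contract (U : finType) (S : {set U}) (Q : U -> {set 'I_n}) i x :
  {in S, forall y : U, #|Q y| = 2%N} ->
  {in S &, forall y z : U, y != z -> [disjoint Q y & Q z]} ->
  {in S, forall y : U, coset_weight (e_ i + indicator (Q y)) = 0%N} ->
  (neighbour_sum (x + e_ i) + 2 * #|S| <= neighbour_sum x + n)%N.
Proof.
move=> cardQ disjQ relQ; rewrite -[X in (_ <= _ + X)%N]card_ord.
apply: (sum_exchange_leq cardQ disjQ) => [y yS|k]; last first.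
  by rewrite addrAC; apply: coset_weight_step.
have /eqP/cards2P[a [b [ab Qab]]] := cardQ y yS.
have : coset_weight (e_ i + (e_ a + e_ b)) = 0%N.
  rewrite -!indicator1 -(indicatorU (A := [set a])) ?disjoints1 ?inE //.
  by rewrite indicator1 -Qab; apply: relQ.
rewrite Qab; move: (e_ i) => ei; clear -ab => rel0.
have swap (u w : word n) : coset_weight (ei + (u + w)) = 0%N ->
    coset_weight (x + ei + u) = coset_weight (x + w).
  move=> uw0; rewrite -(coset_weight_translate (x + ei + u) uw0) addrACA.
  by rewrite -(addrA x) word_addxx addr0 (addrA u) word_addxx add0r.
have sum2 (f : 'I_n -> nat) : (\sum_(k in [set a; b]) f k = f a + f b)%N.
  by rewrite big_setU1 ?inE // big_set1.
apply: (etrans (sum2 _)); apply: (etrans _ (esym (sum2 _))).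
apply: (etrans _ (addnC _ _)); apply: congr2 (swap _ _ rel0) (swap _ _ _).
exact: etrans (congr1 (fun u => coset_weight (ei + u)) (addrC _ _)) rel0.
Qed.

(** A Bonnet-Myers argument. A leader of the coset of [x] is built from 0 in [c = coset_weight x]
    steps outside [A]; [neighbour_sum] starts at most at [n] and rises by at most [n - 2 mu] per
    step. Hence [n c - n <= neighbour_sum x <= n + c (n - 2 mu)], which gives [c mu <= n]. *)
Lemma coset_weight_bound (R : realFieldType) (mu : R) x :
  0 < mu -> (0 < n)%N ->
  (forall i, i \notin A -> forall x,
    (neighbour_sum (x + e_ i))%:R + 2 * mu <= (neighbour_sum x)%:R + n%:R) ->
  (coset_weight x)%:R <= n%:R / mu.
Proof.
move=> mu_gt0 n_gt0 contract.
have arith_step (a b c : R) : a + c * (2 * mu) <= n%:R + c * n%:R ->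
    b + 2 * mu <= a + n%:R -> b + (c + 1) * (2 * mu) <= n%:R + (c + 1) * n%:R.
  by move=> ? ?; lra.
have arith_end (a c : R) : a + c * (2 * mu) <= n%:R + c * n%:R ->
    n%:R * c <= a + n%:R -> c * mu <= n%:R.
  by move=> ? ?; lra.
have walk (K : {set 'I_n}) : [disjoint K & A] ->
    (neighbour_sum (indicator K))%:R + #|K|%:R * (2 * mu)
      <= n%:R + #|K|%:R * n%:R :> R.
  have [k] := ubnP #|K|; elim: k K => // k IH K.
  have [->|[i iK]] := set_0Vmem K.
    by rewrite cards0 !mul0r !addr0 indicator0 ler_nat neighbour_sum0.
  rewrite (cardsD1 i) iK /= add1n ltnS => ltK dKA.
  have dK : [disjoint K :\ i & A] by apply: disjointWl dKA; apply: subsetDl.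
  have := contract i _ (indicator (K :\ i)); rewrite (disjointFr dKA iK).
  have <- : indicator K = indicator (K :\ i) + e_ i.
    rewrite -indicator1 -indicatorU 1?setUC ?setD1K //.
    by rewrite disjoint_sym disjoints1 !inE eqxx.
  move/(_ isT); rewrite -(natr1 #|K :\ i|) => step.
  exact: arith_step (IH _ ltK dK) step.
have [y Dy cardK] := coset_weightP x; set K := supp (x - y) :\: A in cardK.
have dKA : [disjoint K & A].
  by rewrite disjoint_subset; apply/subsetP => i; rewrite !inE => /andP[].
(* [x] and [indicator K] differ by the dual word [y] and a word supported on [A]. *)
have cosetE : coset_weight (x - indicator K) = 0%N.
  apply/eqP; rewrite -leqn0 (leq_trans (coset_weight_le _ Dy)) //.
  rewrite leqn0 cards_eq0 setD_eq0; apply/subsetP => i; rewrite inE !mxE.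
  apply: contraR => iA; rewrite /K !inE iA !mxE /= addrAC -F2_eq_neq0.
  by rewrite subrr.
have sumE : neighbour_sum x = neighbour_sum (indicator K).
  by rewrite -(neighbour_sum_translate (indicator K) cosetE) addrC subrK.
rewrite (ler_pdivlMr _ _ mu_gt0).
have W := walk K dKA.
rewrite cardK in W.
rewrite -sumE in W.
have L := neighbour_sum_ge x.
rewrite -(ler_nat R) natrM natrD in L.
exact: arith_end W L.
Qed.

End CosetWeight.

(** * The random choice of [A] *)

Definition initial_part (T : finType) (k : nat) (D : {set T}) : {set T} :=
  [set t in take k (enum D)].

Lemma initial_part_sub (T : finType) (k : nat) (D : {set T}) :
  initial_part k D \subset D.
Proof. by apply/subsetP => t; rewrite inE => /mem_take; rewrite mem_enum. Qed.

Lemma card_initial_part (T : finType) (k : nat) (D : {set T}) :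
  (k <= #|D|)%N -> #|initial_part k D| = k.
Proof.
move=> leD; rewrite cardsE (card_uniqP (take_uniq _ (enum_uniq _))).
by rewrite size_takel // -cardE.
Qed.

(** Subtracting the dual word [y] leaves a word supported on [B], which dies in the quotient by
    F_2^A. *)
Lemma coset_weight_relation (n : nat) (C : {vspace word n}) (A B : {set 'I_n})
    (y : word n) (i : 'I_n) :
  y \in dual_code C -> i \in supp y -> B \subset A ->
  coset_weight C A (delta_mx 0 i + indicator ((supp y :\ i) :\: B)) = 0%N.
Proof.
move=> Dy iy sBA; apply/eqP; rewrite -leqn0 (leq_trans (coset_weight_le _ _ Dy)) //.
rewrite leqn0 cards_eq0 setD_eq0 -indicator1; apply/subsetP => j; rewrite inE.
rewrite -[y in _ - y]indicator_supp !mxE; apply: contraR => jA.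
have /negPf jB : j \notin B by apply: contra jA; apply: (subsetP sBA).
rewrite in_setD jB in_setD1 in_set1 /=.
have [->|_] := eqVneq j i; first by rewrite iy addr0 subrr.
by rewrite /= add0r subrr.
Qed.

Lemma sparse_quotient (R : realType) (q : nat) (delta p : R) (n : nat)
    (C : {vspace word n}) :
  (2 <= q)%N -> 0 < delta <= 1 -> (0 < n)%N -> 0 < p <= 1 ->
  locally_correctable q delta C ->
  exists A : {set 'I_n},
    #|A|%:R <= n%:R * p + 4 / (delta * p ^+ (q - 2)) /\
    forall x, (coset_weight C A x)%:R <= 2 / (delta * p ^+ (q - 2)).
Proof.
move=> q_ge2 /andP[delta_gt0 delta_le1] n_gt0 /andP[p_gt0 p_le1] lcc.
pose unitd (i : 'I_n) := delta_mx 0 i \in dual_code C.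
(* The empty set is a placeholder for coordinates whose unit vector is dual. *)
have /fin_all_exists[S lccS] (i : 'I_n) : exists S : {set word n}, unitd i \/
    [/\ S \subset dual_code C, delta * n%:R <= #|S|%:R,
        forall y, y \in S -> weight y = q.+1 /\ i \in supp y
      & forall y z, y \in S -> z \in S -> y != z ->
          [disjoint supp y :\ i & supp z :\ i]].
  by have [|[S]] := lcc i; [exists set0; left|exists S; right].
(* A correction of [i] splits into [q - 2] coordinates [B i y], to be caught by [A], and two others
   [Q i y], the ends of the relation. *)
pose B (i : 'I_n) (y : word n) := initial_part (q - 2) (supp y :\ i).
pose Q (i : 'I_n) (y : word n) := (supp y :\ i) :\: B i y.
set w := p ^+ (q - 2).
have w_gt0 : 0 < w by rewrite exprn_gt0.
have w_le1 : w <= 1 by rewrite exprn_ile1 // ltW.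
have nR_gt0 : 0 < n%:R :> R by rewrite ltr0n.
(* Half of the lower bound [delta * n%:R * w] for the mean of [X i]. *)
pose mu := delta * n%:R * w / 2.
have mu_gt0 : 0 < mu by rewrite /mu !mulr_gt0 ?invr_gt0.
pose X i (A : {set 'I_n}) : R := \sum_(y in S i) (B i y \subset A)%:R.
pose bad (A : {set 'I_n}) (i : 'I_n) := ~~ unitd i && (X i A < mu).
have card_supp i : ~~ unitd i -> {in S i, forall y, #|supp y :\ i| = q}.
  move=> /negP Ni y yS; have [//|[_ _ /(_ y yS)[wy iy] _]] := lccS i.
  by move: wy; rewrite /weight (cardsD1 i) iy => -[].
have cardB i : ~~ unitd i -> {in S i, forall y, #|B i y| = (q - 2)%N}.
  by move=> Ni y yS; rewrite card_initial_part // (card_supp i Ni y yS) leq_subr.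
have cardQ i : ~~ unitd i -> {in S i, forall y, #|Q i y| = 2%N}.
  move=> Ni y yS; rewrite cardsDS ?initial_part_sub // (card_supp i Ni y yS).
  by rewrite (cardB i Ni y yS) subKn.
have disj i : ~~ unitd i -> {in S i &, forall y z, y != z ->
    [disjoint supp y :\ i & supp z :\ i]}.
  by move=> /negP Ni y z yS zS; have [//|[_ _ _]] := lccS i; apply.
have disjB i : ~~ unitd i ->
    {in S i &, forall y z, y != z -> [disjoint B i y & B i z]}.
  move=> Ni y z yS zS yz; apply: (disjointWl (initial_part_sub _ _)).
  by apply: (disjointWr (initial_part_sub _ _)); apply: disj.
have disjQ i : ~~ unitd i ->
    {in S i &, forall y z, y != z -> [disjoint Q i y & Q i z]}.
  move=> Ni y z yS zS yz; apply: (disjointWl (subsetDl _ _)).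
  by apply: (disjointWr (subsetDl _ _)); apply: disj.
(* Chebyshev: when [i] is bad, [X i A < mu <= m / 2], so the squared deviation exceeds [m ^+ 2 / 4],
   while its mean is at most [m]. *)
have expect_bad i : expect p (fun A => (bad A i)%:R) <= 4 / (delta * n%:R * w).
  have rhs_ge0 : 0 <= 4 / (delta * n%:R * w).
    by rewrite divr_ge0 // !mulr_ge0 // ltW.
  have [ui|Ni] := boolP (unitd i).
    rewrite (_ : expect _ _ = 0) //; apply: big1 => A _.
    by rewrite /bad ui mulr0.
  have [/idPn//|[_ leS _ _]] := lccS i.
  have := second_moment (ltW p_gt0) (cardB i Ni) (disjB i Ni); rewrite -/w.
  set m := #|S i|%:R * w => EX2.
  have le_m : delta * n%:R * w <= m by rewrite ler_wpM2r // ltW.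
  have m_gt0 : 0 < m by apply: lt_le_trans le_m; rewrite !mulr_gt0.
  apply: (@le_trans _ _ (expect p (fun A => 4 / m ^+ 2 * (X i A - m) ^+ 2))).
    apply: le_expect; rewrite ?(ltW p_gt0) // => A.
    rewrite /bad Ni /=; case: ltP => [ltX|_]; last first.
      by rewrite mulr_ge0 ?sqr_ge0 // divr_ge0 ?sqr_ge0.
    rewrite mulrAC ler_pdivlMr ?exprn_gt0 // mul1r.
    by move: ltX; rewrite /mu; nra.
  rewrite expectZ; apply: (@le_trans _ _ (4 / m ^+ 2 * m)).
    by rewrite ler_wpM2l // divr_ge0 ?sqr_ge0.
  have -> : 4 / m ^+ 2 * m = 4 / m by field; rewrite gt_eqF.
  by rewrite ler_pM2l // lef_pV2 // posrE // !mulr_gt0.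
(* Averaging the sum of both quantities yields one set that controls its size together with the
   number of bad coordinates. *)
have [A0] := exists_le_expect (ltW p_gt0) p_le1
  (fun A => #|A|%:R + \sum_i (bad A i)%:R).
rewrite expectD expect_card expect_sum card_ord => leA0.
have {leA0} cardA : #|A0 :|: [set i | bad A0 i]|%:R <= n%:R * p + 4 / (delta * w).
  apply: le_trans (le_trans leA0 _).
    rewrite -natr_sum -natrD ler_nat (leq_trans (leq_card_setU _ _)) //.
    rewrite leq_add2l -sum1_card big_mkcond leq_sum // => i _.
    by rewrite inE; case: (bad A0 i).
  rewrite lerD2l (le_trans (ler_sum _ (fun i _ => expect_bad i))) //.
  rewrite sumr_const card_ord -mulr_natl le_eqVlt; apply/orP; left.
  by apply/eqP; field; rewrite !gt_eqF.
(* With the bad coordinates adjoined, contraction has to be shown only at good ones. *)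
exists (A0 :|: [set i | bad A0 i]); split=> // x.
have -> : 2 / (delta * w) = n%:R / mu by rewrite /mu; field; rewrite !gt_eqF.
apply: coset_weight_bound => // i.
rewrite in_setU inE negb_or => /andP[_ goodi] y; set A := _ :|: _.
(* A dual unit vector does not change the coset, so contraction reduces to [2 mu <= n], that is,
   [delta * w <= 1]. *)
have [ui|Ni] := boolP (unitd i).
  rewrite neighbour_sum_translate ?coset_weight_dual // lerD2l /mu.
  have : delta * w <= 1 by rewrite mulr_ile1 // ltW.
  by move: nR_gt0; nra.
(* The corrections that [A0] turns into two-ended relations; there are at least [mu] of them since
   [i] is good. *)
pose G := [set z in S i | B i z \subset A0].
have sGS : {subset G <= S i} by move=> z; rewrite inE => /andP[].
have leG : mu <= #|G|%:R.
  have -> : #|G|%:R = X i A0.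
    rewrite -sum1_card natr_sum /X big_mkcond [RHS]big_mkcond.
    apply: eq_bigr => z _; rewrite inE.
    by case: (z \in S i) => //=; case: (_ \subset _).
  by move: goodi; rewrite /bad Ni -leNgt.
apply: (@le_trans _ _ (neighbour_sum C A (y + delta_mx 0 i)%R + 2 * #|G|)%:R).
  by rewrite natrD natrM lerD2l ler_pM2l.
rewrite -(natrD _ (neighbour_sum C A y) n) ler_nat.
apply: (@neighbour_sum_contract _ _ _ _ _ (Q i)).
- by move=> z /sGS; apply: cardQ.
- by move=> z t /sGS zS /sGS; apply: disjQ.
move=> z; rewrite inE => /andP[zS sBA].
have [/idPn//|[/subsetP sD _ /(_ z zS)[_ iz] _]] := lccS i.
apply: coset_weight_relation => //; first exact: sD.
by apply: subset_trans sBA _; apply: subsetUl.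
Qed.

(** * Covering radius and dimension from a bound on coset weights *)

Lemma bigminn_le (I : eqType) (r : seq I) (P : pred I) (F : I -> nat) m j :
  j \in r -> P j -> (\big[minn/m]_(i <- r | P i) F i <= F j)%N.
Proof.
elim: r => // i r IH; rewrite inE big_cons => /orP[/eqP<-|/IH le_j] Pj.
  by rewrite Pj geq_minl.
by case: ifP => _; rewrite ?(leq_trans (geq_minr _ _)) ?le_j.
Qed.

Section Counting.

Variables (n : nat) (C : {vspace word n}) (A : {set 'I_n}) (r : nat).
Hypothesis coset_weight_r : forall x, (coset_weight C A x <= r)%N.

Lemma covering_radius_le : (covering_radius (dual_code C) <= #|A| + r)%N.
Proof.
apply/bigmax_leqP => x _; have [y Dy wy] := coset_weightP C A x.
have := coset_weight_r x; rewrite -wy => le_r.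
apply: leq_trans (bigminn_le _ _ (mem_index_enum y) Dy) _.
by rewrite /weight -(cardsID A) leq_add // subset_leq_card ?subsetIr.
Qed.

(** A word is coded by a set, later taken inside [A], and a list of [r] coordinates; [None] pads
    shorter lists, whence the factor [n.+1 ^ r]. *)
Definition word_of (vh : {set 'I_n} * {ffun 'I_r -> option 'I_n}) : word n :=
  indicator vh.1 + indicator [set i | Some i \in codom vh.2].

Lemma word_of_surj x : exists (V : {set 'I_n}) h y,
  [/\ V \subset A, y \in dual_code C & x = word_of (V, h) + y].
Proof.
have [y Dy wy] := coset_weightP C A x; set z := x - y in wy.
pose h := [ffun j : 'I_r => onth (enum (supp z :\: A)) j].
exists (supp z :&: A), h, y; split; rewrite ?subsetIr //.
have -> : word_of (supp z :&: A, h) = z; last by rewrite subrK.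
rewrite /word_of /= -[RHS]indicator_supp -[in RHS](setID (supp z) A) indicatorU.
  congr (_ + indicator _); apply/setP => i; rewrite inE -[RHS]mem_enum.
  set K := enum _ in h *; have sizeK : (size K <= r)%N by rewrite -cardE wy.
  apply/codomP/idP => [[j]|/onthP[j Kj]].
    by rewrite ffunE => e; apply/onthP; exists j.
  have ltj : (j < size K)%N by rewrite -onthTE Kj.
  by exists (Ordinal (leq_trans ltj sizeK)); rewrite ffunE Kj.
by rewrite disjoint_subset; apply/subsetP => i; rewrite !inE => /andP[_ ->].
Qed.

(** For a generator matrix [M] of [C], the syndrome map [y *m M^T] kills the dual code and is onto,
    as [M] has full row rank. So the words [word_of (V, h)] with [V \subset A] already reach all
    [2 ^ \dim C] syndromes. *)
Lemma dim_le_count : (2 ^ \dim C <= 2 ^ #|A| * n.+1 ^ r)%N.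
Proof.
pose M := \matrix_(i < \dim C) (vbasis C)`_i.
have rfM : row_free M.
  apply: inj_row_free => v; rewrite mulmx_sum_row => v0; apply/rowP => i.
  rewrite mxE; have /freeP := basis_free (vbasisP C); apply.
  by rewrite -[RHS]v0; apply: eq_bigr => j _; rewrite rowK.
have /row_fullP[B BM] : row_full M^T by rewrite /row_full mxrank_tr.
have dualM y : y \in dual_code C -> y *m M^T = 0.
  rewrite inE => /forall_inP Dy; apply/rowP => j; rewrite !mxE.
  have := Dy _ (vbasis_mem (mem_nth 0 (_ : j < size (vbasis C))%N)).
  rewrite size_tuple => /(_ (ltn_ord j))/eqP; apply: etrans; apply: eq_bigr => i _.
  by rewrite !mxE mulrC.
pose D := setX (powerset A) [set: {ffun 'I_r -> option 'I_n}].
have : [set: 'rV['F_2]_(\dim C)] \subset [set word_of vh *m M^T | vh in D].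
  apply/subsetP => v _; have [V [h [y [sVA Dy vBE]]]] := word_of_surj (v *m B).
  apply/imsetP; exists (V, h); first by rewrite !inE sVA.
  by rewrite -[v]mulmx1 -BM mulmxA vBE mulmxDl (dualM y) // addr0.
move/subset_leq_card/leq_trans/(_ (leq_imset_card _ _)).
rewrite cardsX cardsT card_mx mul1n card_Fp // card_powerset cardsT.
by rewrite card_ffun card_option !card_ord.
Qed.

End Counting.

(** * Codes of length at most one, and the choice of the density *)

Lemma lcc_short (R : realType) (q : nat) (delta : R) (n : nat)
    (C : {vspace word n}) :
  (0 < q)%N -> 0 < delta -> (n <= 1)%N -> locally_correctable q delta C ->
  \dim C = 0%N.
Proof.
move=> q_gt0 delta_gt0 n_le1 lcc.
(* Otherwise [S] is nonempty, but a word of weight [q.+1 >= 2] does not fit into length [n <= 1]. *)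
have unit_dual i : delta_mx 0 i \in dual_code C.
  have n_gt0 : (0 < n)%N by rewrite (leq_ltn_trans _ (ltn_ord i)).
  have [//|[S [_ leS wS _]]] := lcc i.
  have : 0 < #|S|%:R :> R by apply: lt_le_trans leS; rewrite mulr_gt0 ?ltr0n.
  rewrite ltr0n card_gt0 => /set0Pn[y /wS[wy _]].
  have : (weight y <= n)%N by rewrite -[leqRHS]card_ord max_card.
  by rewrite wy; lia.
have cw0 x : (coset_weight C set0 x <= 0)%N.
  have [x0|[i ix]] := set_0Vmem (supp x).
    by rewrite (leq_trans (coset_weight_supp _ _ _)) // x0 set0D cards0.
  suff -> : x = delta_mx 0 i by rewrite coset_weight_dual.
  rewrite -indicator1 -[LHS]indicator_supp; congr indicator.
  apply/esym/eqP; rewrite eqEcard sub1set ix cards1 (leq_trans _ n_le1) //.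
  by rewrite -[leqRHS]card_ord max_card.
have := dim_le_count cw0; rewrite cards0 !expn0 muln1.
by case: (\dim C) => // k; rewrite expnS; have := expn_gt0 2 k; lia.
Qed.

(** Taking for [r] the largest coset weight attained gives an integer below the real bound without
    rounding. *)
Lemma sparse_cover (R : realType) (q : nat) (delta p : R) (n : nat)
    (C : {vspace word n}) :
  (2 <= q)%N -> 0 < delta <= 1 -> (0 < n)%N -> 0 < p <= 1 ->
  locally_correctable q delta C ->
  exists a r : nat,
    [/\ a%:R <= n%:R * p + 4 / (delta * p ^+ (q - 2)),
        r%:R <= 2 / (delta * p ^+ (q - 2)),
        (covering_radius (dual_code C) <= a + r)%N &
        (2 ^ \dim C <= 2 ^ a * n.+1 ^ r)%N].
Proof.
move=> q2 d01 n0 p01 lcc; have [A [leA cwA]] := sparse_quotient q2 d01 n0 p01 lcc.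
pose x0 := [arg max_(x > 0 : word n) coset_weight C A x].
have le_r x : (coset_weight C A x <= coset_weight C A x0)%N.
  rewrite /x0; case: arg_maxnP => [|z _ le_z]; [exact: isT|exact: le_z].
exists #|A|, (coset_weight C A x0); split=> //.
  exact: covering_radius_le.
exact: dim_le_count.
Qed.

Theorem theorem1p2 (R : realType) (q : nat) (delta : R)
    (hq : (2 <= q)%N) (hdelta0 : 0 < delta) (hdelta1 : delta < q%:R^-1) :
  exists2 c : R, 0 < c &
    forall (n : nat) (C : {vspace word n}),
      locally_correctable q delta C ->
      (covering_radius (dual_code C))%:R
        <= c * n%:R `^ ((q%:R - 2) / (q%:R - 1)) /\
      (\dim C)%:R
        <= c * n%:R `^ ((q%:R - 2) / (q%:R - 1))
             * ln n%:R `^ (1 / (q%:R - 1)).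
Proof.
have ln2_gt0 : 0 < ln 2 :> R by rewrite ln_gt0 // ltr1n.
have qR : 2 <= q%:R :> R by rewrite ler_nat.
have delta01 : 0 < delta <= 1.
  by rewrite hdelta0 (le_trans (ltW hdelta1)) // invf_le1 ?ltr0n ?ler1n; lia.
set alpha := (q%:R - 2) / (q%:R - 1); set beta := 1 / (q%:R - 1).
have q1_neq0 : q%:R - 1 != 0 :> R by rewrite gt_eqF // subr_gt0; lra.
have alpha_beta : alpha + beta = 1 by rewrite /alpha /beta; field.
have beta_ge0 : 0 <= beta by rewrite divr_ge0 // subr_ge0; lra.
(* For the density [p = x]^ beta[, the probability]p ^+ (q - 2)[is]x [^ alpha]; used with
   [x = 1 / n] and [x = ln n / n]. *)
have powR_root (x : R) : 0 < x -> (x `^ beta) ^+ (q - 2) = x `^ alpha.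
  move=> x_gt0; rewrite -powR_mulrn ?powR_ge0 // -powRrM natrB //.
  by congr (_ `^ _); rewrite /alpha /beta; field.
have pow1 : 1 = 1 `^ beta by rewrite powR1.
have powR_compl (x : R) : 0 < x -> x `^ alpha * x `^ beta = x.
  by move=> x_gt0; rewrite -powRD ?(gt_eqF x_gt0) ?implybT // alpha_beta powRr1 ?ltW.
(* The 1 pays for [n p], and [6 / delta] for the terms [4 / delta] and [2 / delta] of the radius. In
   the dimension bound, [a] and [r] each cost a further [4 / (delta * ln 2)]. *)
pose c := 1 + 6 / delta + 8 / (delta * ln 2).
have d_gt0 : 0 < delta^-1 by rewrite invr_gt0.
have dl_gt0 : 0 < (delta * ln 2)^-1 by rewrite invr_gt0 mulr_gt0.
have c_ge1 : 1 <= c by rewrite /c; lra.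
exists c => [|n C lcc]; first by lra.
have c_ge0 : 0 <= c by lra.
have [n_gt0|] := ltnP 0 n; last first.
  move=> n_le0; split.
    have -> : covering_radius (dual_code C) = 0%N; last first.
      by rewrite mulr_ge0 ?powR_ge0.
    apply/eqP; rewrite -leqn0.
    rewrite (leq_trans (covering_radius_le (A := setT) (r := 0) _)) //.
      move=> x; rewrite (leq_trans (coset_weight_supp _ _ _)) //.
      by rewrite setDT cards0.
    by rewrite addn0 (leq_trans (max_card _)) // card_ord.
  have n_le1 : (n <= 1)%N by apply: leq_trans n_le0 _.
  by rewrite (lcc_short (ltnW hq) hdelta0 n_le1 lcc) !mulr_ge0 ?powR_ge0.
have nR_gt0 : 0 < n%:R :> R by rewrite ltr0n.
split.
  have p01 : 0 < n%:R^-1 `^ beta <= 1.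
    rewrite powR_gt0 ?invr_gt0 //= [leRHS]pow1 ge0_ler_powR // ?nnegrE ?invr_ge0 //.
    by rewrite invf_le1 // ler1n.
  have [a [r [le_a le_r le_cov _]]] := sparse_cover hq delta01 n_gt0 p01 lcc.
  move: le_a le_r; rewrite powR_root ?invr_gt0 // => le_a le_r.
  have invpow e : n%:R^-1 `^ e = (n%:R `^ e)^-1.
    by rewrite -powR_inv1 // -powRrM mulN1r powRN.
  have na_gt0 : 0 < n%:R `^ alpha by apply: powR_gt0.
  have nb_gt0 : 0 < n%:R `^ beta by apply: powR_gt0.
  have np : n%:R * n%:R^-1 `^ beta = n%:R `^ alpha.
    by rewrite invpow -{1}(powR_compl _ nR_gt0) mulfK // gt_eqF.
  have inv k : k / (delta * n%:R^-1 `^ alpha) = k / delta * n%:R `^ alpha.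
    by rewrite invpow; field; rewrite !gt_eqF.
  move: le_a le_r; rewrite np !inv => le_a le_r.
  have : (covering_radius (dual_code C))%:R <= a%:R + r%:R :> R.
    by rewrite -natrD ler_nat.
  have : 0 <= 8 / (delta * ln 2) * n%:R `^ alpha by rewrite !mulr_ge0 // ltW.
  by move: le_a le_r; rewrite /c; lra.
(* At [n = 1] the logarithm, and with it the claimed bound, is 0. *)
have [n_gt1|n_le1] := ltnP 1 n; last first.
  by rewrite (lcc_short (ltnW hq) hdelta0 n_le1 lcc) !mulr_ge0 ?powR_ge0.
set L := ln n%:R.
have L_ge : ln 2 <= L by rewrite ler_ln ?posrE // ler_nat.
have L_gt0 : 0 < L by apply: lt_le_trans L_ge.
have x_gt0 : 0 < L / n%:R by rewrite divr_gt0.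
(* Now [n p = T] and [1 / p ^+ (q - 2) = T / L], so [r * L] is of order [T] as well. *)
have p01 : 0 < (L / n%:R) `^ beta <= 1.
  rewrite powR_gt0 //= [leRHS]pow1 ge0_ler_powR // ?nnegrE //.
    exact: ltW.
  by rewrite ler_pdivrMr // mul1r ltW // ln_sublinear.
have [a [r [le_a le_r _ le_dim]]] := sparse_cover hq delta01 n_gt0 p01 lcc.
move: le_a le_r; rewrite powR_root // => le_a le_r.
set T := n%:R `^ alpha * L `^ beta.
have nb_gt0 : 0 < n%:R `^ beta by apply: powR_gt0.
have na_gt0 : 0 < n%:R `^ alpha by apply: powR_gt0.
have Lb_gt0 : 0 < L `^ beta by apply: powR_gt0.
have La_gt0 : 0 < L `^ alpha by apply: powR_gt0.
have T_gt0 : 0 < T by apply: mulr_gt0.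
have div_pow e : (L / n%:R) `^ e = L `^ e / n%:R `^ e.
  by rewrite powRM ?invr_ge0 ?ltW // -powR_inv1 ?ltW // -powRrM mulN1r powRN.
have np : n%:R * (L / n%:R) `^ beta = T.
  rewrite div_pow -{1}(powR_compl _ nR_gt0) /T; field; exact: lt0r_neq0.
have inv k : k / (delta * (L / n%:R) `^ alpha) = k / delta * (T / L).
  rewrite div_pow -{2}(powR_compl _ L_gt0) /T.
  by field; rewrite !gt_eqF.
move: le_a le_r; rewrite np !inv => le_a le_r.
have TL : T / L <= T / ln 2 by rewrite ler_pM2l // lef_pV2 ?posrE.
have dim_log : (\dim C)%:R * ln 2 <= a%:R * ln 2 + r%:R * (2 * L).
  have lnX (m k : nat) : (0 < m)%N -> ln (m ^ k)%:R = k%:R * ln m%:R :> R.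
    by move=> m_gt0; rewrite natrX lnXn ?ltr0n // mulr_natl.
  (* For [n >= 2], [n + 1 <= n ^ 2] replaces the logarithm of [n + 1] by [2 * L]. *)
  have ln_succ : ln n.+1%:R <= 2 * L.
    have sq : (n.+1 <= n ^ 2)%N by move: n_gt1; clear; rewrite -mulnn; nia.
    rewrite -(lnX n 2%N n_gt0).
    by rewrite ler_ln ?posrE ?ltr0n ?expn_gt0 ?n_gt0 // ler_nat.
  have : ln (2 ^ \dim C)%:R <= ln (2 ^ a * n.+1 ^ r)%:R :> R.
    by rewrite ler_ln ?posrE ?ltr0n ?ler_nat // ?muln_gt0 !expn_gt0.
  rewrite natrM lnM ?posrE ?ltr0n ?expn_gt0 // !lnX // => /le_trans; apply.
  by rewrite lerD2l ler_wpM2l.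
rewrite -mulrA -/T.
have rL : r%:R * (2 * L) <= 4 / delta * T.
  have -> : 4 / delta * T = 2 / delta * (T / L) * (2 * L).
    by field; rewrite !gt_eqF.
  by rewrite ler_wpM2r // mulr_ge0 // ltW.
rewrite -(ler_pM2r ln2_gt0) (le_trans dim_log) //.
have -> : c * T * ln 2 = T * ln 2 + 6 / delta * T * ln 2 + 8 / delta * T.
  by rewrite /c; field; rewrite !gt_eqF.
have le1 : 4 / delta * (T / L) * ln 2 <= 4 / delta * T.
  have -> : 4 / delta * T = 4 / delta * (T / ln 2) * ln 2.
    by field; rewrite !gt_eqF.
  by rewrite ler_pM2r // ler_wpM2l // ltW // mulr_gt0.
have le2 : 0 <= 6 / delta * T * ln 2 by rewrite !mulr_ge0 // ltW.
have le3 : a%:R * ln 2 <= (T + 4 / delta * (T / L)) * ln 2 by rewrite ler_pM2r.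
by move: rL le1 le2 le3; lra.
Qed.
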